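(* Let $(K,\mathcal{O})$ be a valued field of characteristic $p>0$, viewed as a structure in the language of rings expanded by a unary predicate interpreted as $\mathcal{O}$. Suppose every existential formula of this language is NIP with respect to the theory of $(K,\mathcal{O})$. Then $\mathcal{O}$ is henselian.
   Context: A formula $\varphi(x,y)$ has the independence property (IP) with respect to a theory $T$ if there are a model $\mathcal{M}\models T$ and sequences $(a_i)_{i<\omega}$, $(b_S)_{S\subseteq\omega}$ from $\mathcal{M}$ with $\mathcal{M}\models\varphi(a_i,b_S)$ iff $i\in S$; otherwise it is NIP. An existential formula is one of the form $\exists z\,\psi(z,w)$ with $\psi$ quantifier-free. *)

(* Defs.v *)
From mathcomp Require Import all_boot all_order all_algebra.
From mathcomp Require Import classical_sets.

Set Implicit Arguments.
Unset Strict Implicit.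
Unset Printing Implicit Defensive.

Import GRing.Theory.
Local Open Scope ring_scope.

(** The language {0, 1, +, -, *, O} of rings with a unary predicate, in
    well-scoped de Bruijn style: the free variables of a term or formula of
    index [n] are the elements of ['I_n], and a quantifier binds variable 0,
    shifting the others up by one. *)

Inductive term (n : nat) : Type :=
| Var of 'I_n
| Zero
| One
| Add of term n & term n
| Opp of term n
| Mul of term n & term n.

Inductive formula : nat -> Type :=
| Equal n of term n & term n : formula n
| Pred n of term n : formula n
| Not n of formula n : formula n
| And n of formula n & formula n : formula n
| Or n of formula n & formula n : formula n
| Exists n of formula n.+1 : formula n
| Forall n of formula n.+1 : formula n.

Fixpoint quantifier_free n (f : formula n) : bool :=
  match f with
  | Equal _ _ _ | Pred _ _ => true
  | Not _ g => quantifier_free g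
  | And _ g h | Or _ g h => quantifier_free g && quantifier_free h
  | Exists _ _ | Forall _ _ => false
  end.

(** A (possibly empty) block of existential quantifiers in front of a
    quantifier-free formula. *)
Fixpoint existential n (f : formula n) : bool :=
  match f with
  | Exists _ g => existential g
  | g => quantifier_free g
  end.

Record structure : Type := Structure {
  carrier :> Type;
  str_zero : carrier;
  str_one : carrier;
  str_add : carrier -> carrier -> carrier;
  str_opp : carrier -> carrier;
  str_mul : carrier -> carrier -> carrier;
  str_pred : carrier -> Prop
}.

Fixpoint eval (M : structure) n (e : 'I_n -> M) (t : term n) : M :=
  match t with
  | Var i => e i
  | Zero => str_zero M
  | One => str_one M
  | Add t u => str_add (eval e t) (eval e u)
  | Opp t => str_opp (eval e t)
  | Mul t u => str_mul (eval e t) (eval e u)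
  end.

Definition env_cons (M : Type) n (x : M) (e : 'I_n -> M) (i : 'I_n.+1) : M :=
  if unlift ord0 i is Some j then e j else x.

Definition env_cat (M : Type) m n (a : 'I_m -> M) (b : 'I_n -> M)
    (i : 'I_(m + n)) : M :=
  match split i with inl j => a j | inr k => b k end.

Fixpoint sat (M : structure) n (f : formula n) : ('I_n -> M) -> Prop :=
  match f with
  | Equal _ t u => fun e => eval e t = eval e u
  | Pred _ t => fun e => str_pred (eval e t)
  | Not _ g => fun e => ~ sat g e
  | And _ g h => fun e => sat g e /\ sat h e
  | Or _ g h => fun e => sat g e \/ sat h e
  | Exists _ g => fun e => exists x : M, sat g (env_cons x e)
  | Forall _ g => fun e => forall x : M, sat g (env_cons x e)
  end.

Definition sentence := formula 0.

Definition holds (M : structure) (s : sentence) : Prop :=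
  forall e : 'I_0 -> M, sat s e.

Definition theory := sentence -> Prop.

Definition model (M : structure) (T : theory) : Prop :=
  forall s, T s -> holds M s.

Definition Th (M : structure) : theory := holds M.

(** A formula of [formula (m + n)] is read as phi(x, y), with x the tuple of
    the first [m] variables and y that of the last [n]. *)
Definition has_IP (T : theory) m n (phi : formula (m + n)) : Prop :=
  exists M : structure, model M T /\
  exists (a : nat -> 'I_m -> M) (b : set nat -> 'I_n -> M),
    forall i S, sat phi (env_cat (a i) (b S)) <-> S i.

Definition NIP (T : theory) m n (phi : formula (m + n)) : Prop :=
  ~ has_IP T phi.

Definition valuation_ring (K : fieldType) (O : {pred K}) : Prop :=
  subring_closed O /\ forall x : K, x \in O \/ x^-1 \in O.

(** The nonunits of O; zero is listed apart because [0^-1 = 0]. *)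
Definition maximal_ideal (K : fieldType) (O : {pred K}) : {pred K} :=
  [pred x | (x \in O) && ((x == 0) || (x^-1 \notin O))].

(** Every simple zero of the reduction of a polynomial over O lifts to a zero
    in O. *)
Definition henselian (K : fieldType) (O : {pred K}) : Prop :=
  forall (f : {poly K}) (a : K),
    f \is a polyOver O -> a \in O ->
    f.[a] \in maximal_ideal O -> f^`().[a] \notin maximal_ideal O ->
    exists b : K, [/\ b \in O, root f b & b - a \in maximal_ideal O].

Definition valued_field_structure (K : fieldType) (O : {pred K}) : structure :=
  @Structure K 0 1 +%R -%R *%R (fun x => x \in O).

(* Main.v *)
(** Suppose O is not henselian. Then some irreducible monic g over O has an
    approximate simple root -1 that does not lift, and A = K[X]/(g) contains an
    element e = (-X)^k that is idempotent modulo J = m O[X]/(g) but lies in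
    no coset F_p + J. Writing wp(y) = y^p - y, one has wp(e) in J, while wp(e)
    is not in wp(J) because A is a domain.

    For F_p-independent a_1, ..., a_N let Phi be the additive polynomial with
    zero set their span, and let P_j be the additive polynomial of degree
    p^(N-1) with P_j(a_i) = 1 if i = j and 0 otherwise. Both wp(P_j) and Phi
    vanish on the span, so Phi = l_j^p wp(P_j) for a constant l_j. Since P_j is
    additive and e^p = e mod J, the value P_j(x e) is P_j(x) e mod J; hence
    for x a subset sum of the a_i, Phi(x e) lies in l_j^p wp(J) exactly when a_j
    does not occur in x. Thus the existential formula "c in a wp(J)" has the
    independence property, provided that arbitrarily many a_i exist that are
    independent in the residue field, so that all coefficients are in O.

    The same argument with A = K[X]/(X^p - X - d), e = X and J = K shows that K
    is Artin-Schreier closed; then so is the residue field, which is therefore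
    infinite. *)

Require Import Defs.
From HB Require Import structures.
From mathcomp Require Import all_boot all_order all_algebra.
From mathcomp Require Import boolp classical_sets filter.
From mathcomp Require Import qpoly ring zify.

Set Implicit Arguments.
Unset Strict Implicit.
Unset Printing Implicit Defensive.

Import GRing.Theory.
Local Open Scope ring_scope.

(** * Ultrapowers and shattering *)

Lemma sval_cid_eq (T : Type) (P Q : T -> Prop) (exP : exists x, P x)
  (exQ : exists x, Q x) : P = Q -> sval (cid exP) = sval (cid exQ).
Proof. by move=> E; case: _ / E exQ => exQ;
  rewrite (Prop_irrelevance exP exQ). Qed.

Section Ultrapower.
Context (M : structure) (U : set_system nat) {UU : UltraFilter U}.
Local Open Scope classical_set_scope.

Definition ueq (f g : nat -> M) : Prop := U [set i | f i = g i].

Lemma ueq_refl f : ueq f f.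
Proof. by apply: filterS filterT => i _. Qed.

Lemma ueq_sym f g : ueq f g -> ueq g f.
Proof. by apply: filterS => i /= ->. Qed.

Lemma ueq_trans f g h : ueq f g -> ueq g h -> ueq f h.
Proof. by move=> fg gh; apply: filterS (filterI fg gh) => i [/= -> ->]. Qed.

Definition urepr (f : nat -> M) : nat -> M :=
  sval (cid (ex_intro (ueq f) f (ueq_refl f))).

Lemma ueq_urepr f : ueq f (urepr f).
Proof. by rewrite /urepr; case: cid. Qed.

Lemma urepr_eq f g : ueq f g -> urepr f = urepr g.
Proof.
move=> fg; have E : ueq f = ueq g.
  apply/funext => h; apply/propext; split; last exact: ueq_trans.
  exact/ueq_trans/ueq_sym.
exact: sval_cid_eq.
Qed.

(** Keeping only the chosen representative of each class makes Leibniz equality express equality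
    almost everywhere, without a quotient type. *)
Definition upower_carrier := {f : nat -> M | urepr f = f}.

Definition upi (f : nat -> M) : upower_carrier :=
  exist _ (urepr f) (esym (urepr_eq (ueq_urepr f))).

Lemma upiE f g : upi f = upi g <-> ueq f g.
Proof.
split=> [/(congr1 sval)/= E|/urepr_eq E]; last exact: eq_exist.
by apply: ueq_trans (ueq_urepr f) _; rewrite E; apply/ueq_sym/ueq_urepr.
Qed.

Lemma svalK x : upi (sval x) = x.
Proof. by case: x => f fK; apply: eq_exist. Qed.

Definition upower : structure :=
  @Structure upower_carrier (upi (fun=> str_zero M)) (upi (fun=> str_one M))
    (fun x y => upi (fun i => str_add (sval x i) (sval y i)))
    (fun x => upi (fun i => str_opp (sval x i)))
    (fun x y => upi (fun i => str_mul (sval x i) (sval y i)))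
    (fun x => U [set i | str_pred (sval x i)]).

Lemma eval_upower n (F : 'I_n -> nat -> M) (t : term n) :
  @eval upower n (fun j => upi (F j)) t =
  upi (fun i => eval (fun j => F j i) t).
Proof.
elim: t => //= [t -> u ->|t ->|t -> u ->]; apply/upiE.
- apply: filterS (filterI (ueq_urepr (fun i => eval (fun j => F j i) t))
    (ueq_urepr (fun i => eval (fun j => F j i) u))) => i [/= E1 E2].
  by rewrite -E1 -E2.
- apply: filterS (ueq_urepr (fun i => eval (fun j => F j i) t)) => i /= E1.
  by rewrite -E1.
- apply: filterS (filterI (ueq_urepr (fun i => eval (fun j => F j i) t))
    (ueq_urepr (fun i => eval (fun j => F j i) u))) => i [/= E1 E2].
  by rewrite -E1 -E2.
Qed.

Lemma env_cons_upi n f (F : 'I_n -> nat -> M) :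
  env_cons (upi f) (fun j => upi (F j)) = fun j => upi (env_cons f F j).
Proof. by apply/funext => j; rewrite /env_cons; case: unlift. Qed.

Lemma env_cons_app n (f : nat -> M) (F : 'I_n -> nat -> M) i :
  (fun j => env_cons f F j i) = env_cons (f i) (fun j => F j i).
Proof. by apply/funext => j; rewrite /env_cons; case: unlift. Qed.

Lemma ultraC (A : set nat) : U (~` A) <-> ~ U A.
Proof.
split=> [UnA UA|nUA]; last by have [] := in_ultra_setVsetC A UU.
by have [i []] := filter_ex (filterI UA UnA).
Qed.

(** Induction on [phi]; negation, disjunction and the universal quantifier use that [U] contains
    every set or its complement. *)
Lemma los n (phi : formula n) (F : 'I_n -> nat -> M) :
  @sat upower n phi (fun j => upi (F j)) <->
  U [set i | sat phi (fun j => F j i)].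
Proof.
elim: n / phi F => //= [n t u|n t|n g IH|n g IHg h IHh|n g IHg h IHh|n g IH|n g
  IH] F.
- by rewrite !eval_upower upiE.
- rewrite eval_upower /=; split=> H.
    apply: filterS (filterI H (ueq_urepr (fun i => eval (fun j => F j i) t))).
    by move=> i [/= + ->].
  apply: filterS (filterI H (ueq_urepr (fun i => eval (fun j => F j i) t))).
  by move=> i [/= + <-].
- rewrite IH -ultraC; exact: iff_refl.
- rewrite IHg IHh; split=> [[A B]|H]; first exact: filterS (filterI A B).
  by split; apply: filterS H => i [].
- rewrite IHg IHh; split=> [[]|H]; [by apply: filterS; left|by apply: filterS;
  right|].
  apply: contrapT => /not_orP[/ultraC A /ultraC B].
  by have [i [[]]] := filter_ex (filterI H (filterI A B)) => + [].
- split=> [[x]|H].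
    rewrite -(svalK x) env_cons_upi IH; apply: filterS => i /=.
    by rewrite env_cons_app; exists (sval x i).
  (* Pointwise witnesses, with default [str_zero M] at the indices that have none. *)
  pose f i :=
    if pselect (exists x, sat g (env_cons x (fun j => F j i))) is left p
    then sval (cid p) else str_zero M.
  exists (upi f); rewrite env_cons_upi IH; apply: filterS H => i /= ex.
  by rewrite env_cons_app /f; case: pselect => // p; case: cid.
- split=> [H|H x]; last first.
    rewrite -(svalK x) env_cons_upi IH; apply: filterS H => i /=.
    by rewrite env_cons_app.
  apply: contrapT => /ultraC H'.
  (* Pointwise counterexamples form an element of the ultrapower that refutes [H]. *)
  pose f i :=
    if pselect (exists x, ~ sat g (env_cons x (fun j => F j i))) is left p
    then sval (cid p) else str_zero M.
  have := H (upi f); rewrite env_cons_upi IH => H''.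
  have [i [/= + /existsNP]] := filter_ex (filterI H'' H').
  by rewrite env_cons_app /f; case: pselect => // p; case: cid.
Qed.

Lemma upower_model : model upower (Th M).
Proof.
move=> s Ms e; have -> : e = (fun j => upi (fun=> str_zero M)).
  by apply/funext => -[].
by rewrite los; apply: filterS filterT => i _; apply: Ms.
Qed.

End Ultrapower.

Definition shatters (M : structure) m n (phi : formula (m + n)) (N : nat) :
  Prop :=
  exists (a : nat -> 'I_m -> M) (b : set nat -> 'I_n -> M),
    forall i S, (i < N)%N -> sat phi (env_cat (a i) (b S)) <-> S i.

(** The [N]-th configurations are glued in an ultrapower. As [U] refines the cofinite filter, each
    fixed [i] satisfies [i < N] for almost all [N]. *)
Lemma shatters_has_IP (M : structure) m n (phi : formula (m + n)) :
  (forall N, shatters M phi N) -> has_IP (Th M) phi.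
Proof.
move=> H.
have [U [UU sU]] := ultraFilterLemma eventually_filter.
have [a /choice[b ab]] := choice H.
exists (@upower M U UU); split; first exact: upower_model.
exists (fun i j => @upi M U UU (fun N => a N i j)), (fun S j => @upi M U UU
  (fun N => b N S j)) => i S.
have -> : env_cat (fun j => @upi M U UU (fun N => a N i j))
    (fun j => @upi M U UU (fun N => b N S j)) =
  fun j => @upi M U UU (fun N => env_cat (a N i) (b N S) j).
  by apply/funext => j; rewrite /env_cat; case: (fintype.split j).
rewrite los.
have Ui : U [set N | (i < N)%N]%classic by apply: sU; exists i.+1.
split=> [UA|Si]; last by apply: filterS Ui => N /= iN; apply/ab.
by have [N [/= + iN]] := filter_ex (filterI UA Ui); rewrite ab.
Qed.

(** * Additive polynomials vanishing on an F_p-subspace *)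

Section Frobenius.
Context (R : comNzRingType) (p : nat) (charR : p \in [pchar R]).

Lemma expBp (x y : R) : (x - y) ^+ p = x ^+ p - y ^+ p.
Proof. exact: (rmorphB (pFrobenius_aut charR)). Qed.
End Frobenius.

Section Moore.
Context (K : fieldType) (p : nat) (charK : p \in [pchar K]).

Let p_gt0 : (0 < p)%N := prime_gt0 (pcharf_prime charK).

(** The value at [x] of the monic additive polynomial with zero set the F_p-span
    of [s]. *)
Fixpoint moore (s : seq K) (x : K) : K :=
  if s is a :: s' then moore s' x ^+ p - moore s' a ^+ p.-1 * moore s' x else x.

Lemma mooreB s x y : moore s (x - y) = moore s x - moore s y.
Proof.
elim: s => //= a s ->; rewrite (expBp charK).
by move: (_ ^+ p) (_ ^+ p) (_ ^+ p.-1) => u v c; ring.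
Qed.

Lemma moore0 s : moore s 0 = 0.
Proof. by rewrite -[X in moore s X](subrr 0) mooreB subrr. Qed.

Lemma mooreD s x y : moore s (x + y) = moore s x + moore s y.
Proof.
have mooreN z : moore s (- z) = - moore s z.
  by rewrite -sub0r mooreB moore0 sub0r.
by rewrite -[y in LHS]opprK mooreB mooreN opprK.
Qed.

Lemma moore_sum s I r (P : pred I) F :
  moore s (\sum_(i <- r | P i) F i) = \sum_(i <- r | P i) moore s (F i).
Proof. exact: (big_morph _ (mooreD s) (moore0 s)). Qed.

Lemma moore_vanish s x : x \in s -> moore s x = 0.
Proof.
elim: s => //= a s IH; rewrite inE => /orP[/eqP->|/IH->].
  by rewrite -exprSr prednK // subrr.
by rewrite mulr0 subr0 expr0n -[p == 0]negbK -lt0n p_gt0.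
Qed.

Section Alg.
Context (A : comAlgType K).

Let charA : p \in [pchar A]. Proof. by rewrite pchar_lalg. Qed.

(** The polynomial of [moore], with coefficients in [K], evaluated in a [K]-algebra; it will be
    applied to multiples of [e]. *)
Fixpoint moore_alg (s : seq K) (z : A) : A :=
  if s is a :: s' then
    moore_alg s' z ^+ p - moore s' a ^+ p.-1 *: moore_alg s' z
  else z.

(* The coefficient of X^p in the additive polynomial of [a, b]: its product with
   the Moore determinant a^p b - a b^p is alternating in [a] and [b]. *)
Lemma dickson_sym (a b : K) (q : nat) : q.+1 \in [pchar K] ->
  a ^+ q.+1 * b - a * b ^+ q.+1 != 0 ->
  (b ^+ q) ^+ q.+1 + (a ^+ q.+1 - b ^+ q * a) ^+ q =
  (a ^+ q) ^+ q.+1 + (b ^+ q.+1 - a ^+ q * b) ^+ q.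
Proof.
move=> charq D0.
have H (u v : K) : ((v ^+ q) ^+ q.+1 + (u ^+ q.+1 - v ^+ q * u) ^+ q) *
    (u ^+ q.+1 * v - u * v ^+ q.+1) =
    (u ^+ q.+1) ^+ q.+1 * v - (v ^+ q.+1) ^+ q.+1 * u.
  have -> : u ^+ q.+1 * v - u * v ^+ q.+1 = (u ^+ q.+1 - v ^+ q * u) * v.
    by rewrite !exprS; ring.
  rewrite mulrDl mulrA [X in _ + X]mulrA -exprSr (expBp charq) exprMn.
  by rewrite !exprS !exprMn; ring.
apply: (mulIf D0); rewrite H.
have -> : a ^+ q.+1 * b - a * b ^+ q.+1 =
    - (b ^+ q.+1 * a - b * a ^+ q.+1) by ring.
by rewrite mulrN H; ring.
Qed.

(** With [f] the value for [s], both sides combine [f^(p^2)], [f^p] and [f]. The coefficients of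
    [f^p] agree by [dickson_sym]; those of [f] are the (p-1)-st powers of a Moore determinant and of
    its negative. *)
Lemma moore_alg_swap a b s z :
  moore s a ^+ p * moore s b - moore s a * moore s b ^+ p != 0 ->
  moore_alg (a :: b :: s) z = moore_alg (b :: a :: s) z.
Proof.
move: p_gt0 charK charA => /=; case: p => // q _ charq charAq /= D0.
move: (moore s a) (moore s b) (moore_alg s z) D0 => {}a {}b f D0.
have H (u v : K) : (f ^+ q.+1 - v ^+ q *: f) ^+ q.+1 -
    (u ^+ q.+1 - v ^+ q * u) ^+ q *: (f ^+ q.+1 - v ^+ q *: f) =
  (f ^+ q.+1) ^+ q.+1 -
    ((v ^+ q) ^+ q.+1 + (u ^+ q.+1 - v ^+ q * u) ^+ q) *: f ^+ q.+1
    + (u ^+ q.+1 * v - v ^+ q * u * v) ^+ q *: f.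
  rewrite (expBp charAq) exprZn scalerBr scalerDl scalerA -mulrBl exprMn.
  by rewrite opprB opprD !addrA addrAC.
rewrite !H dickson_sym //; congr (_ + _ *: _).
have -> : b ^+ q.+1 * a - a ^+ q * b * a =
  - (a ^+ q.+1 * b - b ^+ q * a * b) by rewrite !exprS; ring.
(* For [p = 2] the signs coincide; for odd [p] the exponent [q = p - 1] is even. *)
rewrite exprNn; suff -> : (-1) ^+ q = 1 :> K by rewrite mul1r.
have [e2|o2] := boolP (q == 1%N).
  move: charq; rewrite (eqP e2) expr1 => c2.
  by apply/eqP; rewrite eq_sym -subr_eq0 opprK -(pcharf0 c2).
have /even_prime[[q1]|/=] := pcharf_prime charq; first by rewrite q1 eqxx in o2.
by move=> oq; rewrite -signr_odd (negbTE oq).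
Qed.

End Alg.

Lemma moore_alg_regular s (x : K) : moore_alg s (x : K^o) = moore s x.
Proof. by elim: s => //= a s ->. Qed.

Section Subring.
Context (O : subringClosed K).

Definition subunit (x : K) : bool := [&& x != 0, x \in O & x^-1 \in O].

Lemma subunit_mem x : subunit x -> x \in O. Proof. by case/and3P. Qed.

Lemma subunitM x y : x \in O -> y \in O ->
  subunit (x * y) = subunit x && subunit y.
Proof.
move=> Ox Oy; rewrite /subunit Ox Oy rpredM //= mulf_eq0 negb_or.
have [//|x0] /= := eqVneq x 0; have [|y0] /= := eqVneq y 0;
  first by rewrite andbF.
apply/idP/andP=> [Oxy|[Ox1 Oy1]]; last by rewrite invfM rpredM.
have xy : x^-1 = y * (x * y)^-1 by rewrite invfM mulrCA mulfV // mulr1.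
have yx : y^-1 = x * (x * y)^-1 by rewrite invfM mulVKf.
by rewrite xy yx !rpredM.
Qed.

Lemma subunitN x : subunit (- x) = subunit x.
Proof. by rewrite /subunit oppr_eq0 invrN !rpredN. Qed.

(** For a valuation ring [O]: the residues of [s] are F_p-independent. *)
Fixpoint moore_indep (s : seq K) : bool :=
  if s is a :: s' then [&& a \in O, subunit (moore s' a) & moore_indep s']
  else true.

Lemma moore_indep_mem s a : moore_indep s -> a \in s -> a \in O.
Proof.
elim: s => //= b s IH /and3P[Ob _ /IH H]; rewrite inE.
by case/orP=> [/eqP->|/H].
Qed.

Lemma moore_indep_uniq s : moore_indep s -> uniq s.
Proof.
elim: s => //= a s IH /and3P[_ u /IH->]; rewrite andbT.
by apply/negP => /moore_vanish E; rewrite /subunit E eqxx in u.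
Qed.

Lemma moore_mem s x : moore_indep s -> x \in O -> moore s x \in O.
Proof.
move=> si Ox; elim: s si => //= a s IH /and3P[_ /subunit_mem Oa /IH Os].
by rewrite rpredB ?rpredM ?rpredX.
Qed.

(** Two values are units exactly when their product is. Here the product is the Moore determinant of
    [moore s a] and [moore s b], which only changes sign under the exchange. *)
Lemma moore_indep_swap a b s :
  moore_indep (a :: b :: s) = moore_indep (b :: a :: s).
Proof.
rewrite /=; have [si|] := boolP (moore_indep s); rewrite ?andbF // !andbT.
have [Oa|_] := boolP (a \in O); last by rewrite !andbF.
have [Ob|_] := boolP (b \in O); last by rewrite !andbF.
rewrite /= -!subunitM ?rpredB ?rpredM ?rpredX ?moore_mem // -subunitN.
congr subunit; have := p_gt0; case: (p) => // q _; rewrite /= !exprS; ring.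
Qed.

Lemma moore_indep_swap_neq0 a b s : moore_indep (a :: b :: s) ->
  moore s a ^+ p * moore s b - moore s a * moore s b ^+ p != 0.
Proof.
rewrite /= => /and3P[_ /and3P[u0 _ _] /and3P[_ /and3P[v0 _ _] _]].
have := mulf_neq0 u0 v0; congr (_ != 0).
have := p_gt0; case: (p) => // q _; rewrite /= !exprS; ring.
Qed.

(** Adjacent swaps bring [a] to the front, so any member can be treated as the last one adjoined. *)
Lemma moore_rem s a : moore_indep s -> a \in s ->
  [/\ moore_indep (a :: rem a s), moore (a :: rem a s) =1 moore s &
      forall A : comAlgType K, @moore_alg A (a :: rem a s) =1 @moore_alg A s].
Proof.
elim: s => [//|b s IH] /and3P[Ob ub si]; rewrite inE eq_sym.
case: (eqVneq b a) Ob ub => [->|nab] Ob ub.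
  by move=> _; rewrite [rem _ _]/= eqxx; split=> //; apply/and3P.
rewrite [rem _ _]/= (negbTE nab) [_ || _]/=.
move=> /(IH si)[si' E EA].
have si'' : moore_indep (b :: a :: rem a s).
  by apply/and3P; split=> //; rewrite E.
have D0 := moore_indep_swap_neq0 si''.
have EA' (A : comAlgType K) : moore_alg (a :: b :: rem a s) =1 @moore_alg A (b
  :: s).
  by move=> z; rewrite -moore_alg_swap // [LHS]/= -/(moore_alg (a :: rem a s)
    z) EA [RHS]/= -E.
split=> //; first by rewrite -moore_indep_swap.
(* The scalar identity is the case of [K] as an algebra over itself. *)
by move=> x; have := EA' K^o x; rewrite !moore_alg_regular.
Qed.

(** * Separating the members of an independent family *)

Section Separation.
Context (A : comAlgType K) (J : zmodClosed A) (e : A) (s : seq K).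
Hypothesis s_indep : moore_indep s.
Hypothesis JZ : forall a j, a \in O -> j \in J -> a *: j \in J.
Hypothesis JX : forall j, j \in J -> j ^+ p \in J.
Hypothesis Je : e ^+ p - e \in J.
Hypothesis eNJ : forall j, j \in J -> j ^+ p - j <> e ^+ p - e.

Let charA : p \in [pchar A]. Proof. by rewrite pchar_lalg. Qed.

(** Since [e^p = e] modulo [J], the map [x |-> x e] commutes with Frobenius there, hence with
    additive polynomials over [O]; [JX] and [JZ] keep the error terms in [J]. *)
Lemma moore_alg_scale t x : moore_indep t -> x \in O ->
  moore_alg t (x *: e) - moore t x *: e \in J.
Proof.
move=> ti Ox; elim: t ti => [|a t IH] /=; first by rewrite subrr rpred0.
move=> /and3P[_ /subunit_mem Oa ti].
have := moore_mem ti Ox; move: (IH ti) => {IH}; rewrite -(rpredN J) opprB.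
move: (moore t x) (moore t a) Oa => X c Oc Jd OX.
set d := _ - _ in Jd.
have -> : moore_alg t (x *: e) = X *: e - d by rewrite /d opprB addrC subrK.
rewrite (expBp charA) exprZn.
suff -> : X ^+ p *: e ^+ p - d ^+ p - c ^+ p.-1 *: (X *: e - d)
     - (X ^+ p - c ^+ p.-1 * X) *: e =
   X ^+ p *: (e ^+ p - e) - d ^+ p + c ^+ p.-1 *: d.
  by rewrite rpredD ?rpredB ?JX ?JZ ?rpredX.
rewrite !scalerBr scalerBl !scalerA;
  move: (_ *: _) (_ *: _) (_ *: _) (_ *: _) => u v w k.
ring.
Qed.

(** Let [z] be the value of [moore_alg (rem a s)] at [x e] divided by [l]. The value for all of [s]
    is [l^p wp(z)], and modulo [J] the element [z] is [e] or 0 as [a] occurs in [T] or not. In the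
    second case [y = z] works; in the first, [wp(y) = wp(z)] gives [wp(y - (z - e)) = wp(e)],
    against [eNJ]. *)
Lemma moore_separation a T : a \in s -> uniq T -> {subset T <= s} ->
  (exists2 y, y \in J & moore (rem a s) a ^+ p *: (y ^+ p - y) =
     moore_alg s ((\sum_(b <- T) b) *: e)) <-> a \notin T.
Proof.
move=> sa uT Ts; set x := \sum_(b <- T) b.
have Ox : x \in O.
  by rewrite /x big_seq rpred_sum // => b /Ts /moore_indep_mem->.
have [/= /and3P[_ ul ri] _ /(_ A (x *: e)) <-] := moore_rem s_indep sa.
set l := moore (rem a s) a in ul *.
have l0 : l != 0 by case/and3P: ul.
(* The polynomial of [rem a s] kills every summand except possibly [a]. *)
have mx : moore (rem a s) x = (a \in T)%:R * l.
  rewrite /x moore_sum; have [aT|aT] := boolP (a \in T).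
    rewrite (bigD1_seq a) //= big_seq_cond big1 ?addr0 ?mul1r // => b /andP[bT
      ba].
    by apply: moore_vanish;
      rewrite (rem_filter _ (moore_indep_uniq s_indep)) mem_filter /= ba Ts.
  rewrite big_seq big1 ?mul0r // => b bT; apply: moore_vanish.
  rewrite (rem_filter _ (moore_indep_uniq s_indep)) mem_filter Ts // andbT /=.
  by apply: contraNneq aT => <-.
have := moore_alg_scale ri Ox; rewrite mx; set M := moore_alg _ _ => JM.
have JM' : l^-1 *: M - (a \in T)%:R *: e \in J.
  rewrite -[_ *: e](scalerK l0) -scalerBr JZ //; first by case/and3P: ul.
  by rewrite scalerA mulrC.
rewrite /= -/l -/M.
have -> : M ^+ p - l ^+ p.-1 *: M = l ^+ p *: ((l^-1 *: M) ^+ p - (l^-1 *: M)).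
  rewrite scalerBr exprZn !scalerA -exprMn divff // expr1n scale1r.
  rewrite (_ : l ^+ p / l = l ^+ p.-1) //.
  by rewrite -[in LHS](prednK p_gt0) exprSr mulfK.
move: {M JM mx} (l^-1 *: M) JM' => z.
have lp0 : l ^+ p != 0 by rewrite expf_neq0.
case: (a \in T) => /=; rewrite ?scale1r ?scale0r ?subr0 => Jz; split=> //.
  case=> y Jy /(can_inj (scalerK lp0)) E.
  have := eNJ (rpredB Jy Jz); case.
  rewrite !(expBp charA).
  move: (y ^+ p) (z ^+ p) (e ^+ p) E => u v w E.
  have -> : u - (v - w) - (y - (z - e)) = (u - y) - (v - z) + (w - e) by ring.
  by rewrite E subrr add0r.
by move=> _; exists z.
Qed.

End Separation.
End Subring.
End Moore.

(** * The Artin-Schreier formula *)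

Lemma env_cat_lshift (M : Type) m n (a : 'I_m -> M) (b : 'I_n -> M) i :
  env_cat a b (lshift n i) = a i.
Proof. by rewrite /env_cat -[lshift _ _]/(unsplit (inl _)) unsplitK. Qed.

Lemma env_cat_rshift (M : Type) m n (a : 'I_m -> M) (b : 'I_n -> M) i :
  env_cat a b (rshift m i) = b i.
Proof. by rewrite /env_cat -[rshift _ _]/(unsplit (inr _)) unsplitK. Qed.

Lemma env_cat_cons (M : Type) m n x (a : 'I_m -> M) (b : 'I_n -> M) :
  env_cat (env_cons x a) b = env_cons x (env_cat a b) :> ('I_(m.+1 + n) -> M).
Proof.
apply/funext => i; rewrite [RHS]/env_cons.
case: unliftP => [j|] ->; last first.
  have -> : ord0 = lshift n (@ord0 m) by apply: val_inj.
  by rewrite env_cat_lshift /env_cons unlift_none.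
rewrite -(splitK j); case: (fintype.split j) => k /=.
  have -> : lift ord0 (lshift n k) = lshift n (lift ord0 k) by apply: val_inj.
  by rewrite !env_cat_lshift /env_cons liftK.
have -> : lift ord0 (rshift m k) = rshift m.+1 k by apply: val_inj.
by rewrite !env_cat_rshift.
Qed.

Lemma env_cons_surj (M : Type) n (a : 'I_n.+1 -> M) :
  a = env_cons (a ord0) (fun i => a (lift ord0 i)).
Proof. by apply/funext => i; rewrite /env_cons; case: unliftP => [j|] ->. Qed.

(** A quantifier binds variable 0, so a block binds an initial segment of the variables; hence [a]
    comes first in [env_cat]. *)
Lemma exists_block m n (phi : formula (m + n)) : existential phi ->
  exists2 psi : formula n, existential psi & forall (M : structure) (b : 'I_n
    -> M),
    sat psi b <-> exists a : 'I_m -> M, sat phi (env_cat a b).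
Proof.
elim: m phi => [|m IH] phi ex_phi.
  exists phi => // M b; have E (a : 'I_0 -> M) : env_cat a b = b.
    apply/funext => i; rewrite -[i in RHS](splitK i) /env_cat.
    by case: (fintype.split i) => [[]|k] //=; congr b; apply: val_inj.
  split=> [H|[a]]; last by rewrite E.
  have a : 'I_0 -> M by case.
  by exists a; rewrite E.
have [psi ex_psi psiE] := IH (@Exists (m + n) phi) ex_phi.
exists psi => // M b; rewrite psiE; split=> [[a /= [x]]|[a Ha]].
  by rewrite -env_cat_cons; exists (env_cons x a).
exists (fun i => a (lift ord0 i)); exists (a ord0).
by rewrite -env_cat_cons -env_cons_surj.
Qed.

Section Syntax.
Context (K : fieldType) (O : {pred K}).
Let M := valued_field_structure O.

Definition term_exp n (t : term n) k : term n := iter k (Mul t) (One n).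

Lemma eval_exp n (e : 'I_n -> M) t k : eval e (term_exp t k) = (eval e t : K)
  ^+ k.
Proof. by elim: k => //= k ->; rewrite exprS. Qed.

Definition term_sum n d (F : 'I_d -> term n) : term n :=
  foldr (fun i => Add (F i)) (Zero n) (index_enum 'I_d).

Lemma eval_sum n d (e : 'I_n -> M) (F : 'I_d -> term n) :
  eval e (term_sum F) = \sum_i (eval e (F i) : K).
Proof.
rewrite /term_sum; elim: (index_enum _) => [|i s IH] /=;
  first by rewrite big_nil.
by rewrite big_cons IH.
Qed.

Definition formula_all n d (F : 'I_d -> formula n) : formula n :=
  foldr (fun i => And (F i)) (Equal (Zero n) (Zero n)) (enum 'I_d).

Lemma qf_formula_all n d (F : 'I_d -> formula n) :
  (forall i, quantifier_free (F i)) -> quantifier_free (formula_all F).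
Proof. by move=> qfF; rewrite /formula_all; elim: (enum _) => //= i s ->;
  rewrite qfF. Qed.

Lemma sat_formula_all n d (e : 'I_n -> M) (F : 'I_d -> formula n) :
  sat (formula_all F) e <-> forall i, sat (F i) e.
Proof.
have -> : (forall i, sat (F i) e) <-> (forall i, i \in enum 'I_d -> sat (F i)
  e).
  by split=> H i; [move=> _|apply: H; rewrite mem_enum].
rewrite /formula_all; elim: (enum _) => [|i s IH] //=; rewrite IH; split.
  by move=> [Fi Fs] j; rewrite inE => /orP[/eqP->|/Fs].
by move=> Fs; split=> [|j js]; apply: Fs; rewrite inE ?eqxx ?js ?orbT.
Qed.

Section ArtinSchreier.
Context (p d : nat).
Context (theta : forall n, 'I_d -> term n -> term n -> formula n).
Context (T : 'I_d -> K -> K -> Prop).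
Hypothesis theta_qf : forall n i (t u : term n), quantifier_free (theta i t u).
Hypothesis theta_sat : forall n i (t u : term n) (e : 'I_n -> M),
  sat (theta i t u) e <-> T i (eval e t) (eval e u).

(** In coordinates, this says that [c] lies in [a wp(J)]. [R] holds the coordinates of the p-th
    powers of the basis, passed as parameters; [T i y w] says that [w] witnesses that [y] may be the
    [i]-th coordinate of an element of [J]. *)
Lemma artin_schreier_formula : exists2 phi : formula (1 + (d + d * d)),
  existential phi & forall a (c : 'I_d -> K) (R : 'M[K]_d),
    @sat M _ phi (env_cat (fun=> a) (env_cat c (fun l => mxvec R 0 l))) <->
    exists2 y : 'I_d -> K, (forall i, exists w, T i (y i) w) &
      forall k, a * (\sum_i R i k * y i ^+ p - y k) = c k.
Proof.
(* Order of the variables: the bound coordinates [y] and witnesses [w], then [a], [c] and the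
   flattened matrix [R]. *)
pose N := ((d + d) + (1 + (d + d * d)))%N.
pose vy i : term N := Var (lshift _ (lshift d i)).
pose vw i : term N := Var (lshift _ (rshift d i)).
pose va : term N := Var (rshift _ (lshift _ ord0)).
pose vc i : term N := Var (rshift _ (rshift 1 (lshift _ i))).
pose vr i k : term N := Var (rshift _ (rshift 1 (rshift d (mxvec_index i k)))).
pose body : formula N := And
  (formula_all (fun i => theta i (vy i) (vw i)))
  (formula_all (fun k => Equal (Mul va
     (Add (term_sum (fun i => Mul (vr i k) (term_exp (vy i) p))) (Opp (vy k))))
     (vc k))).
have qf_body : quantifier_free body by rewrite /= !qf_formula_all.
have [phi ex_phi phiE] := @exists_block _ _ body qf_body.
exists phi => // a c R; rewrite phiE {phiE ex_phi}.
set b := env_cat _ _.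
have bodyE (y w : 'I_d -> K) : @sat M _ body (env_cat (env_cat y w) b) <->
    (forall i, T i (y i) (w i)) /\
    forall k, a * (\sum_i R i k * y i ^+ p - y k) = c k.
  rewrite /body [sat _ _]/= !sat_formula_all.
  set env := env_cat _ b.
  have evy i : @eval M _ env (vy i) = y i by rewrite /= /env /b !env_cat_lshift.
  have evw i : @eval M _ env (vw i) = w i by rewrite /= /env /b env_cat_lshift
    env_cat_rshift.
  have evr i k : @eval M _ env (vr i k) = R i k by rewrite /= /env /b
    !env_cat_rshift mxvecE.
  have eva : @eval M _ env va = a by rewrite /= /env /b env_cat_rshift
    env_cat_lshift.
  have evc k : @eval M _ env (vc k) = c k.
    by rewrite /= /env /b !env_cat_rshift env_cat_lshift.
  have evs k : @eval M _ env (term_sum (fun i => Mul (vr i k) (term_exp (vy i)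
    p)))
      = \sum_i R i k * y i ^+ p.
    rewrite eval_sum; apply: eq_bigr => i _.
    by rewrite -[LHS]/((@eval M _ env (vr i k) : K) *
      @eval M _ env (term_exp (vy i) p)) eval_exp evr evy.
  have Ty : (forall i, @sat M _ (theta i (vy i) (vw i)) env)
      <-> forall i, T i (y i) (w i).
    by split=> H i; move: (H i); rewrite theta_sat evy evw.
  rewrite Ty; suff Ek k : (a * (\sum_i R i k * y i ^+ p - y k) = c k) =
      ((@eval M _ env va : K) *
       (@eval M _ env (term_sum (fun i => Mul (vr i k) (term_exp (vy i) p)))
         - @eval M _ env (vy k)) = @eval M _ env (vc k)).
    by split=> -[Ti E]; split=> // k; move: (E k); rewrite Ek.
  by rewrite evs eva evy evc.
split=> [[x]|[y Ty E]].
  have -> : x = env_cat (fun i => x (lshift d i)) (fun i => x (rshift d i)).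
    apply/funext => i; rewrite -(splitK i); case: (fintype.split i) => j /=.
      by rewrite env_cat_lshift.
    by rewrite env_cat_rshift.
  move=> /bodyE[Tx E]; exists (fun i => x (lshift d i)) => // i.
  by exists (x (rshift d i)).
by have [w Tw] := choice Ty; exists (env_cat y w); apply/bodyE.
Qed.

Section Algebra.
Context (charK : p \in [pchar K]) (A : comAlgType K).
Context (basis : 'I_d -> A) (co : A -> 'I_d -> K).
Hypothesis co_linear : forall a x y k, co (a *: x + y) k = a * co x k + co y k.
Hypothesis co_basis : forall x, x = \sum_i co x i *: basis i.
Hypothesis co_sum : forall y : 'I_d -> K, co (\sum_i y i *: basis i) = y.

Let charA : p \in [pchar A]. Proof. by rewrite pchar_lalg. Qed.

Lemma co0 k : co 0 k = 0.
Proof.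
by apply: (addrI (co 0 k)); rewrite -{1}[co 0 k]mul1r -co_linear scale1r !addr0.
Qed.

Lemma coZ a x k : co (a *: x) k = a * co x k.
Proof. by rewrite -[a *: x]addr0 co_linear co0 addr0. Qed.

(** Frobenius is semilinear, so the coordinates of [x^p] are linear in the p-th powers of those of
    [x]. *)
Lemma co_artin_schreier a x k : co (a *: (x ^+ p - x)) k =
  a * (\sum_i co (basis i ^+ p) k * co x i ^+ p - co x k).
Proof.
have coN y : co (- y) k = - co y k by rewrite -scaleN1r coZ mulN1r.
rewrite coZ -[_ - x]add0r; congr (_ * _).
rewrite add0r -[_ ^+ p]scale1r co_linear mul1r coN; congr (_ - _).
rewrite {1}(co_basis x); move: (co x) => y.
have -> : (\sum_i y i *: basis i) ^+ p = \sum_i y i ^+ p *: basis i ^+ p.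
  rewrite -(pFrobenius_autE charA) rmorph_sum; apply: eq_bigr => i _ /=.
  by rewrite pFrobenius_autE exprZn.
elim/big_rec2: _ => [|i u v _ <-]; first by rewrite co0.
by rewrite co_linear mulrC.
Qed.

(** An independent list [s] of length [N] shatters [N] points: the points are the constants [l^p] of
    its members, and [S] is coded by the coordinates of the polynomial of [s] at [x e], for a subset
    sum [x]. *)
Lemma artin_schreier_IP (O' : subringClosed K) (J : zmodClosed A) (e : A) :
  (forall x, x \in J <-> forall i, exists w, T i (co x i) w) ->
  (forall a j, a \in O' -> j \in J -> a *: j \in J) ->
  (forall j, j \in J -> j ^+ p \in J) ->
  e ^+ p - e \in J -> (forall j, j \in J -> j ^+ p - j <> e ^+ p - e) ->
  (forall N, exists2 s, size s = N & moore_indep p O' s) ->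
  exists2 phi : formula (1 + (d + d * d)), existential phi & has_IP (Th M) phi.
Proof.
move=> JT JZ JX Je eNJ indep.
have [phi ex_phi phiE] := artin_schreier_formula.
exists phi => //; apply: shatters_has_IP => N.
have [s sN si] := indep N; have us := moore_indep_uniq charK si.
pose l a := moore p (rem a s) a ^+ p.
(* The complement of [S] is summed, because [moore_separation] holds for the members that do not
   occur. *)
pose tl (S : set nat) := [seq nth 0 s j | j <- iota 0 N & ~~ `[< S j >]].
pose c S := moore_alg p s ((\sum_(b <- tl S) b) *: e).
exists (fun i _ => l (nth 0 s i)), (fun S => env_cat (co (c S))
  (fun k => mxvec (\matrix_(i, k) co (basis i ^+ p) k) 0 k)) => i S iN.
rewrite phiE.
have iN' : (i < size s)%N by rewrite sN.
have inN j : (j \in iota 0 N) = (j < size s)%N by rewrite mem_iota sN.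
have utl : uniq (tl S).
  rewrite map_inj_in_uniq ?filter_uniq ?iota_uniq // => j k.
  rewrite !mem_filter !inN => /andP[_ jN] /andP[_ kN] /eqP.
  by rewrite nth_uniq // => /eqP.
have stl : {subset tl S <= s}.
  by move=> _ /mapP[j + ->]; rewrite mem_filter inN => /andP[_ /mem_nth].
have si' : nth 0 s i \in s by rewrite mem_nth.
have -> : S i <-> nth 0 s i \notin tl S.
  split=> [Si|/negP H].
    apply/mapP => -[j]; rewrite mem_filter inN => /andP[/asboolPn nSj jN] /eqP.
    by rewrite nth_uniq // => /eqP ij; apply: nSj; rewrite -ij.
  apply: contrapT => nSi; apply: H; apply/mapP; exists i => //.
  by rewrite mem_filter inN iN' andbT; apply/asboolPn.
rewrite -(moore_separation charK si JZ JX Je eNJ si' utl stl) -/(c S) -/(l _).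
split=> [[y Ty E]|[y /JT Jy E]].
  have Ey := co_sum y; exists (\sum_i y i *: basis i).
    by apply/JT => k; rewrite Ey.
  rewrite (co_basis (c S)) (co_basis (_ *: _)); apply: eq_bigr => k _.
  rewrite co_artin_schreier Ey -E; congr (_ * (_ - _) *: _).
  by apply: eq_bigr => j _; rewrite mxE.
exists (co y) => // k; rewrite -E co_artin_schreier; congr (_ * (_ - _)).
by apply: eq_bigr => j _; rewrite mxE.
Qed.

End Algebra.
End ArtinSchreier.
End Syntax.

(** * Products over F_p and valuation rings *)

Section FpProduct.
Context (K : fieldType) (p : nat) (charK : p \in [pchar K]).

Let p_gt1 : (1 < p)%N := prime_gt1 (pcharf_prime charK).

Lemma polyXp_subX :
  'X^p - 'X = \prod_(k <- iota 0 p) ('X - k%:R%:P) :> {poly K}.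
Proof.
pose rs : seq K := [seq k%:R | k <- iota 0 p].
have sp : size ('X^p - 'X : {poly K}) = p.+1.
  by rewrite size_polyDl size_polyXn // size_polyN size_polyX ltnS.
have rsP : all (root ('X^p - 'X)) rs.
  apply/allP => _ /mapP[k _ ->]; rewrite /root !hornerE.
  by rewrite -(pFrobenius_autE charK) rmorph_nat subrr.
have inj (j k : nat) : (j <= k < p)%N -> j%:R = k%:R :> K -> j = k.
  move=> /andP[jk kp] /eqP;
    rewrite eq_sym -subr_eq0 -natrB // -(dvdn_pcharf charK).
  have [/eqP|k0 /(dvdn_leq k0)] := posnP (k - j)%N.
    by rewrite subn_eq0 => kj _; apply/eqP; rewrite eqn_leq jk.
  by rewrite leqNgt (leq_ltn_trans (leq_subr _ _) kp).
have urs : uniq rs.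
  rewrite map_inj_in_uniq ?iota_uniq // => j k; rewrite !mem_iota /= => jp kp.
  have [jk|/ltnW kj] := leqP j k; first by apply: inj; rewrite jk.
  by move=> /esym E; apply/esym/inj => //; rewrite kj.
have := all_roots_prod_XsubC _ rsP; rewrite uniq_rootsE sp size_map size_iota.
move=> -> //; rewrite big_map.
suff -> : lead_coef ('X^p - 'X : {poly K}) = 1 by rewrite scale1r.
rewrite lead_coefDl ?lead_coefXn //.
by rewrite size_polyXn size_polyN size_polyX ltnS.
Qed.

Lemma poly_expp_sub (y : {poly K}) :
  y ^+ p - y = \prod_(k <- iota 0 p) (y - k%:R%:P).
Proof.
have := congr1 (fun q => q \Po y) polyXp_subX.
rewrite comp_polyB comp_polyX rmorphXn /= comp_polyX => ->.
by rewrite rmorph_prod; apply: eq_bigr => k _;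
  rewrite /= comp_polyB comp_polyX comp_polyC.
Qed.

(** The homogeneous form of [polyXp_subX], by substituting [x / y]; for [y = 0] both sides are
    [x^p]. *)
Lemma expp_subM (x y : K) :
  x ^+ p - y ^+ p.-1 * x = \prod_(k <- iota 0 p) (x - y *+ k).
Proof.
have [->|y0] := eqVneq y 0.
  have -> : 0 ^+ p.-1 = 0 :> K by move: p_gt1; case: (p) => [|[|q]] // _;
    rewrite expr0n.
  rewrite mul0r subr0.
  under eq_bigr => k _ do rewrite mul0rn subr0.
  by rewrite big_const_seq count_predT size_iota -Monoid.iteropE.
have yx : y * (x / y) = x by rewrite mulrCA mulfV // mulr1.
have -> : x ^+ p - y ^+ p.-1 * x = y ^+ p * ('X^p - 'X).[x / y].
  rewrite !hornerE mulrBr -exprMn yx -[in X in _ = _ - X](prednK (ltnW p_gt1)).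
  by rewrite exprSr -mulrA yx.
rewrite polyXp_subX horner_prod.
have -> : y ^+ p = \prod_(k <- iota 0 p) y.
  by rewrite big_const_seq count_predT size_iota -Monoid.iteropE.
rewrite -big_split; apply: eq_bigr => k _ /=.
by rewrite !hornerE mulrBr yx mulr_natr.
Qed.

Fixpoint Fp_span (s : seq K) : seq K :=
  if s is a :: s' then [seq v + a *+ k | k <- iota 0 p, v <- Fp_span s']
  else [:: 0].

(** The recursion of [moore] is [expp_subM] at [moore s x] and [moore s a]; additivity moves
    [a *+ k] inside, where induction applies. *)
Lemma moore_prod s x : moore p s x = \prod_(v <- Fp_span s) (x - v).
Proof.
elim: s x => [|a s IH] x /=; first by rewrite big_seq1 subr0.
rewrite expp_subM big_allpairs_dep; apply: eq_bigr => k _.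
have -> : moore p s x - moore p s a *+ k = moore p s (x - a *+ k).
  rewrite mooreB //; congr (_ - _).
  elim: k => [|k IHk]; first by rewrite !mulr0n moore0.
  by rewrite !mulrS mooreD // IHk.
by rewrite IH; apply: eq_bigr => v _; rewrite opprD addrA addrAC.
Qed.

(** Greedy choice: the next residue avoids the finite span of the previous ones, so every factor in
    [moore_prod] is a unit. *)
Lemma moore_indep_exists (O : subringClosed K) :
  (forall s : seq K, {subset s <= O} ->
     exists2 a, a \in O & forall v, v \in s -> subunit O (a - v)) ->
  forall N, exists2 s, size s = N & moore_indep p O s.
Proof.
move=> H; elim=> [|N [s sN si]]; first by exists [::].
have spO : {subset Fp_span s <= O}.
  elim: {N sN} s si => [_ v|a s IH /and3P[Oa _ /IH sO] _ /allpairsP[[k v] /= [_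
    /sO Ov ->]]].
    by rewrite inE => /eqP->; rewrite rpred0.
  by rewrite rpredD ?rpredMn.
have [a Oa aH] := H _ spO; exists (a :: s); first by rewrite /= sN.
apply/and3P; split=> //; rewrite moore_prod.
suff : (\prod_(v <- Fp_span s) (a - v) \in O) && subunit O (\prod_(v <- Fp_span
  s) (a - v)).
  by case/andP.
rewrite big_seq; elim/big_ind: _ => [|x y /andP[Ox ux] /andP[Oy uy]|v vs].
- by rewrite /subunit oner_eq0 invr1 rpred1.
- by rewrite subunitM // ux uy rpredM.
- by rewrite aH // rpredB // spO.
Qed.

End FpProduct.

(** * Gauss's lemma and division over a valuation ring *)

Section Valuation.
Context (K : fieldType) (O : subringClosed K).
Hypothesis valO : forall x, x \in O \/ x^-1 \in O.
Local Notation m := (maximal_ideal O).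

Lemma maximal_idealE x : (x \in m) = (x \in O) && ~~ subunit O x.
Proof.
rewrite inE /= /subunit; case: (x \in O) => //=.
by rewrite negb_and negbK.
Qed.

Lemma maximal_idealW x : x \in m -> x \in O.
Proof. by case/andP. Qed.

Lemma subunitE x : x \in O -> subunit O x = (x \notin m).
Proof. by rewrite maximal_idealE => ->; rewrite negbK. Qed.

Lemma maximal_idealM x y : x \in O -> y \in O ->
  (x * y \in m) = (x \in m) || (y \in m).
Proof.
by move=> Ox Oy; rewrite !maximal_idealE rpredM // subunitM // Ox Oy negb_and.
Qed.

Lemma maximal_ideal_mull x y : x \in O -> y \in m -> x * y \in m.
Proof. by move=> Ox my; rewrite maximal_idealM ?my ?orbT // maximal_idealW. Qed.

Lemma maximal_idealX x n : x \in m -> x ^+ n.+1 \in m.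
Proof.
by move=> mx; rewrite exprSr maximal_ideal_mull // rpredX // maximal_idealW.
Qed.

Lemma maximal_ideal1 : 1 \notin m.
Proof. by rewrite -subunitE ?rpred1 // /subunit oner_eq0 invr1 rpred1. Qed.

Lemma maximal_ideal_inv x : x \notin O -> x^-1 \in m.
Proof.
move=> Ox; have [/(negP Ox)[]|Ox1] := valO x.
by rewrite inE /= Ox1 invrK Ox orbT.
Qed.

Lemma maximal_ideal_zmod_closed : zmod_closed m.
Proof.
have m0 : 0 \in m by rewrite inE /= rpred0 eqxx.
have mN x : x \in m -> - x \in m by rewrite !maximal_idealE rpredN subunitN.
have mD x y : x \in m -> y \in m -> x / y \in O -> x + y \in m.
  move=> mx my Oxy; have [->|y0] := eqVneq y 0; first by rewrite addr0.
  have -> : x + y = (x / y + 1) * y by rewrite mulrDl divfK // mul1r.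
  by rewrite maximal_ideal_mull // rpredD ?rpred1.
split=> // x y mx my; have [Oxy|Oyx] := valO (x / - y); first by rewrite mD ?mN.
by rewrite addrC mD ?mN //; rewrite invf_div in Oyx.
Qed.

Definition max_ideal : zmodClosed K :=
  HB.pack (maximal_ideal O : {pred K})
    (GRing.isZmodClosed.Build K _ maximal_ideal_zmod_closed).

(** Divisibility is total in a valuation ring, so some nonzero entry has least valuation. *)
Lemma exists_dvd (s : seq K) : has (fun x => x != 0) s ->
  exists2 x, (x != 0) && (x \in s) & forall y, y \in s -> y / x \in O.
Proof.
elim: s => //= a s IH; have [->|a0] /= := eqVneq a 0.
  move=> /IH[x /andP[x0 xs] H]; exists x; first by rewrite x0 inE xs orbT.
  by move=> y; rewrite inE => /orP[/eqP->|/H//]; rewrite mul0r rpred0.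
move=> _; case: (boolP (has (fun x => x != 0) s)) => [/IH[x /andP[x0 xs]
  H]|/hasPn H].
  have [Oax|] := valO (a / x).
    exists x; first by rewrite x0 inE xs orbT.
    by move=> y; rewrite inE => /orP[/eqP->|/H].
  rewrite invf_div => Oxa; exists a; first by rewrite a0 inE eqxx.
  move=> y; rewrite inE => /orP[/eqP->|/H Oyx]; first by rewrite divff ?rpred1.
  have -> : y / a = (y / x) * (x / a) by rewrite mulrA divfK.
  exact: rpredM.
exists a; first by rewrite a0 inE eqxx.
move=> y; rewrite inE => /orP[/eqP->|/H]; first by rewrite divff ?rpred1.
by rewrite negbK => /eqP->; rewrite mul0r rpred0.
Qed.

Lemma primitive_scale (q : {poly K}) : q != 0 ->
  exists c, [/\ c != 0, c *: q \is a polyOver O & c *: q \isn't a polyOver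
    max_ideal].
Proof.
move=> q0; have : has (fun x => x != 0) (q : seq K).
  apply/hasP; exists (lead_coef q); last by rewrite lead_coef_eq0.
  by rewrite /lead_coef mem_nth // prednK // size_poly_gt0.
case/exists_dvd => x /andP[x0 /(nthP 0)[i isz xi]] H.
exists x^-1; split; first by rewrite invr_eq0.
  apply/polyOverP => j; rewrite coefZ mulrC.
  have [jq|qj] := ltnP j (size q); first by rewrite H ?mem_nth.
  by rewrite nth_default // mul0r rpred0.
apply/negP => /polyOverP/(_ i); rewrite coefZ xi mulVf //.
by apply/negP/maximal_ideal1.
Qed.

(** If [i] and [j] are the first indices with coefficients outside [m], the product has coefficient
    [u_i v_j] modulo [m] at [i + j], and [m] is prime. *)
Lemma gauss_primitive (u v : {poly K}) :
  u \is a polyOver O -> v \is a polyOver O ->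
  u \isn't a polyOver max_ideal -> v \isn't a polyOver max_ideal -> u * v
    \isn't a polyOver max_ideal.
Proof.
have first (w : {poly K}) : w \isn't a polyOver max_ideal ->
    exists2 i, w`_i \notin m & forall j, (j < i)%N -> w`_j \in m.
  move=> /polyOverP H.
  have /existsNP[i0 /negP Hi0] := H.
  have ex : exists i, w`_i \notin m by exists i0.
  exists (ex_minn ex); case: ex_minnP => // i Hi imin j ji.
  by apply: contraLR ji => /imin; rewrite -leqNgt.
move=> /polyOverP uO /polyOverP vO /first[i ui iu] /first[j vj jv].
apply/negP => /polyOverP/(_ (i + j)%N); apply/negP.
have ij : (i < (i + j).+1)%N by rewrite ltnS leq_addr.
rewrite coefM (bigD1 (Ordinal ij)) //= addKn.
set S := \sum_(k | _) _.
have mS : S \in max_ideal.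
  apply: rpred_sum => k; rewrite -val_eqE /= => ki.
  have [ki'|ik] := ltnP k i.
    by rewrite mulrC [_ \in _]maximal_ideal_mull // iu.
  rewrite [_ \in _]maximal_ideal_mull // jv //.
  rewrite ltn_subLR; last by rewrite -ltnS.
  by rewrite ltn_add2r ltn_neqAle eq_sym ki.
apply/negP => mE; have : u`_i * v`_j \in max_ideal by rewrite -(addrK S (_ *
  _)) rpredB.
by rewrite [_ \in _]maximal_idealM // (negbTE ui) (negbTE vj).
Qed.

(** Primitive multiples [c q] and [d r] have leading coefficients [c] and [d] in [O]. Were [c d] in
    [m], their product would not be primitive; so [c] is a unit. *)
Lemma gauss_monic (q r : {poly K}) : q \is monic -> r \is monic ->
  q * r \is a polyOver O -> q \is a polyOver O.
Proof.
move=> qm rm qrO.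
have [c [c0 cO cm]] := primitive_scale (monic_neq0 qm).
have [d [d0 dO dm]] := primitive_scale (monic_neq0 rm).
have := gauss_primitive cO dO cm dm; rewrite -scalerAl -scalerAr scalerA => cdm.
have lcO (a : K) (t : {poly K}) : t \is monic -> a *: t \is a polyOver O -> a
  \in O.
  by move=> /monicP tm /polyOverP/(_ (size t).-1);
    rewrite coefZ -lead_coefE tm mulr1.
have Oc := lcO _ _ qm cO; have Od := lcO _ _ rm dO.
have : c * d \notin m.
  apply: contra cdm => mcd; apply/polyOverP => i; rewrite coefZ mulrC.
  by rewrite [_ \in _]maximal_ideal_mull // (polyOverP qrO).
rewrite -subunitE ?rpredM // subunitM // => /andP[/and3P[_ _ Oc1] _].
by rewrite -(scalerK c0 q); apply: polyOverZ.
Qed.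

(** Induction on the degree: monic factors stay over [O] by [gauss_monic], and since [m] is prime
    one of them takes a value in [m] at [x]. *)
Lemma irreducible_factor (q : {poly K}) x : x \in O -> q \is monic ->
  q \is a polyOver O -> q.[x] \in m ->
  exists g, [/\ g \is monic, irreducible_poly g, g \is a polyOver O,
                g.[x] \in m & g %| q].
Proof.
move=> Ox; have [n] := ubnP (size q); elim: n q => // n IH q qn qm qO mq.
have [qirr|qred] := pselect (irreducible_poly q); first by exists q.
have q1 : (1 < size q)%N.
  rewrite ltnNge; apply/negP => /size1_polyC E.
  move: qm mq; rewrite E monicE lead_coefC hornerC => /eqP->.
  exact/negP/maximal_ideal1.
have [r [r1 rq nrq]] : exists r : {poly K}, [/\ size r != 1, r %| q & ~~ (r %=
  q)].
  apply: contrapT => H; apply: qred; split=> // r r1 rq.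
  by apply/negPn/negP => nrq; apply: H; exists r.
have q0 := monic_neq0 qm; have r0 : r != 0 by apply: contraTneq rq => ->;
  rewrite dvd0p.
have l0 : lead_coef r != 0 by rewrite lead_coef_eq0.
pose u := (lead_coef r)^-1 *: r.
have um : u \is monic by rewrite monicE lead_coefZ mulVf.
have us : size u = size r by rewrite size_scale ?invr_eq0.
have uq : u %| q by rewrite dvdpZl ?invr_eq0.
have /dvdpP[v E] := uq.
have vm : v \is monic by move: qm; rewrite E monicMr.
have r2 : (1 < size r)%N.
  by have := r0; rewrite -size_poly_gt0; case: (size r) r1 => [|[|]].
have rltq : (size r < size q)%N.
  by rewrite ltn_neqAle dvdp_leq // andbT (dvdp_size_eqp rq).
have vltq : (size v < size q)%N.
  rewrite E size_Mmonic ?monic_neq0 // us.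
  by case: (size r) r2 => [|[|k]] // _; rewrite !addnS /= ltnS leq_addr.
have uO : u \is a polyOver O by apply: gauss_monic um vm _; rewrite mulrC -E.
have vO : v \is a polyOver O by apply: gauss_monic vm um _; rewrite -E.
move: mq; rewrite E hornerM maximal_idealM ?rpred_horner //.
case/orP=> [mv|mu].
  have [g [gm girr gO mg gv]] := IH _ (leq_trans vltq qn) vm vO mv.
  by exists g; split=> //; apply: (dvdp_trans gv); rewrite dvdp_mulr.
have ultq : (size u < n)%N by rewrite us; apply: leq_trans rltq qn.
have [g [gm girr gO mg gu]] := IH _ ultq um uO mu.
by exists g; split=> //; apply: (dvdp_trans gu); rewrite dvdp_mull.
Qed.

(** Long division by a monic [g] only multiplies coefficients of [q] by elements of [O]. The cases
    used are [S = O] and [S = m]. *)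
Lemma monic_division (S : zmodClosed K) (g q : {poly K}) :
  (forall a x, a \in O -> x \in S -> a * x \in S) ->
  g \is monic -> g \is a polyOver O -> q \is a polyOver S ->
  q %/ g \is a polyOver S /\ q %% g \is a polyOver S.
Proof.
move=> SO gm gO; have [n] := ubnP (size q); elim: n q => // n IH q qn qS.
have [qg|gq] := ltnP (size q) (size g);
  first by rewrite divp_small // modp_small //; split=> //; apply: rpred0.
have [->|q0] := eqVneq q 0; first by rewrite div0p mod0p; split; apply: rpred0.
pose u := lead_coef q *: 'X^(size q - size g); pose t := u * g.
have g0 := monic_neq0 gm.
have st : size t = size q.
  by rewrite /t /u -scalerAl size_scale ?lead_coef_eq0 // mulrC size_mulXn //
    subnK.
have uS : u \is a polyOver S.
  apply/polyOverP => i; rewrite coefZ coefXn mulr_natr.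
  by rewrite rpredMn // lead_coefE (polyOverP qS).
have tS : t \is a polyOver S.
  apply/polyOverP => i; rewrite coefM rpred_sum // => j _; rewrite mulrC.
  by rewrite SO ?(polyOverP gO) ?(polyOverP uS).
have : (size (q - t)%R < size q)%N.
  have lt : lead_coef t = lead_coef q.
    by rewrite lead_coefM lead_coefZ lead_coefXn (monicP gm) !mulr1.
  have : (size (q - t)%R <= size q)%N.
    by rewrite (leq_trans (size_polyD _ _)) // size_polyN st maxnn.
  rewrite leq_eqVlt => /orP[/eqP E|//].
  have : lead_coef (q - t) = 0.
    by rewrite lead_coefE E coefB -{1}lead_coefE -st -lead_coefE lt subrr.
  by move/eqP; rewrite lead_coef_eq0 => /eqP->;
    rewrite size_poly0 size_poly_gt0.
move/leq_trans/(_ qn)/IH => /(_ (rpredB qS tS))[IHd IHm].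
by rewrite -[q](subrK t) divpD modpD mulpK // modp_mull addr0; split=> //;
  exact: rpredD.
Qed.

End Valuation.

(** * NIP fields are Artin-Schreier closed *)

Section QpolyBasis.
Context (K : fieldType) (g : {poly K}).
Hypotheses (g_monic : g \is monic) (g_gt1 : (1 < size g)%N).

(** [mk_monic] substitutes a default modulus unless its argument is monic of positive degree. *)
Lemma mk_monicE : mk_monic g = g.
Proof. by rewrite /mk_monic g_gt1 g_monic. Qed.

Lemma in_qpolyE q : in_qpoly g q = q %% g :> {poly K}.
Proof.
by rewrite /= mk_monicE Pdiv.Field.modpE (monicP g_monic) expr1n invr1 scale1r.
Qed.

Lemma in_qpoly_eq q r : in_qpoly g q = in_qpoly g r <-> g %| q - r.
Proof.
split=> [/(congr1 (@polyn _ _))|qr].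
  by rewrite !in_qpolyE => E; rewrite /dvdp modpD modpN E subrr.
apply: val_inj; rewrite [LHS]in_qpolyE [RHS]in_qpolyE; apply/eqP.
by rewrite -subr_eq0 -modpN -modpD.
Qed.

Lemma in_qpolyK (x : {poly %/ g}) : in_qpoly g x = x.
Proof. by apply/val_inj/in_qpoly_small/size_mk_monic. Qed.

Let d := (size g).-1.

Lemma qpoly_co_linear a (x y : {poly %/ g}) k :
  (a *: x + y : {poly %/ g})`_k = a * x`_k + y`_k.
Proof. by rewrite poly_of_qpolyD poly_of_qpolyZ coefD coefZ. Qed.

Lemma size_qpoly (x : {poly %/ g}) : (size x <= d)%N.
Proof. by apply: leq_trans (size_npoly x) _; rewrite mk_monicE. Qed.

Lemma qpoly_basis (x : {poly %/ g}) :
  x = \sum_(i < d) x`_i *: in_qpoly g 'X^i.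
Proof.
under eq_bigr => i _ do rewrite -in_qpolyZ.
rewrite -linear_sum -[in LHS](in_qpolyK x); congr in_qpoly.
rewrite -poly_def; apply/polyP => i; rewrite coef_poly; case: ltnP => // di.
by rewrite nth_default // (leq_trans (size_qpoly x)).
Qed.

Lemma qpoly_co_sum (y : 'I_d -> K) :
  (fun k : 'I_d => (\sum_i y i *: in_qpoly g 'X^i : {poly %/ g})`_k) = y.
Proof.
apply/funext => k; under eq_bigr => i _ do rewrite -in_qpolyZ.
rewrite -linear_sum in_qpolyE modp_small; last first.
  apply: (@leq_ltn_trans d); last by rewrite /d; case: (size g) g_gt1.
  apply: (leq_trans (size_sum _ _ _)); apply/bigmax_leqP => i _.
  by rewrite (leq_trans (size_scale_leq _ _)) // size_polyXn.
rewrite coef_sum (bigD1 k) //= big1 => [|i ik].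
  by rewrite coefZ coefXn eqxx mulr1 addr0.
by rewrite coefZ coefXn (inj_eq val_inj) eq_sym (negbTE ik) mulr0.
Qed.

End QpolyBasis.

Section Full.
Context (K : fieldType).

Lemma predT_subring_closed : subring_closed (predT : {pred K}).
Proof. by []. Qed.

Definition full_subring : subringClosed K :=
  HB.pack (predT : {pred K})
    (GRing.isSubringClosed.Build K predT predT_subring_closed).

End Full.

Lemma artin_schreier_closed (K : fieldType) (O : {pred K}) (p : nat) :
  p \in [pchar K] ->
  (forall m n (phi : formula (m + n)),
     existential phi -> NIP (Th (valued_field_structure O)) phi) ->
  (forall s : seq K, exists a, a \notin s) ->
  forall x : K, exists y, y ^+ p - y = x.
Proof.
move=> charK nip K_inf c; apply: contrapT => nc.
have p_gt1 := prime_gt1 (pcharf_prime charK).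
pose g : {poly K} := 'X^p - 'X - c%:P.
have sXc : (size ('X + c%:P)%R < p.+1)%N.
  by rewrite size_XaddC ltnS.
have sg : size g = p.+1.
  by rewrite /g -addrA -opprD size_polyDl size_polyXn // size_polyN.
have gm : g \is monic.
  rewrite monicE /g -addrA -opprD lead_coefDl ?lead_coefXn //.
  by rewrite size_polyXn size_polyN.
have g1 : (1 < size g)%N by rewrite sg ltnS ltnW.
pose A : comAlgType K := {poly %/ g}.
pose d := (size g).-1.
have constE a : in_qpoly g a%:P = a%:P :> {poly K}.
  by rewrite in_qpolyE // modp_small // (leq_ltn_trans (size_polyC_leq1 _)).
(* [J] is the copy of [K] in [A]. *)
pose Jp : {pred A} := [pred x : A | size (x : {poly K}) <= 1]%N.
have JpP x : reflect (exists a, x = in_qpoly g a%:P) (x \in Jp).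
  apply: (iffP idP) => [/size1_polyC E|[a ->]]; last first.
    by rewrite inE constE size_polyC_leq1.
  by exists (x : {poly K})`_0; rewrite -E in_qpolyK.
have JpB : zmod_closed Jp.
  split=> [|_ _ /JpP[a ->] /JpP[b ->]]; apply/JpP.
    by exists 0; rewrite polyC0 in_qpoly0.
  by exists (a - b); rewrite polyCB linearB.
pose J : zmodClosed A := HB.pack Jp (GRing.isZmodClosed.Build A Jp JpB).
(* Coordinates of positive index must vanish, while that of index 0 is free. *)
pose theta n (i : 'I_d) (t u : term n) : formula n :=
  if val i == 0%N then Equal (Zero n) (Zero n) else Equal t (Zero n).
pose T (i : 'I_d) (y w : K) := val i != 0%N -> y = 0.
have theta_qf n i (t u : term n) : quantifier_free (theta n i t u).
  by rewrite /theta; case: ifP.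
have theta_sat n i (t u : term n) (e : 'I_n -> valued_field_structure O) :
    sat (theta n i t u) e <-> T i (eval e t) (eval e u).
  rewrite /theta /T; case: (val i == 0%N) => /=; split=> //; exact.
pose co (x : A) (k : 'I_d) := (x : {poly K})`_k.
have [||||||phi ex_phi] := artin_schreier_IP theta_qf theta_sat charK
  (A := A) (co := co) (basis := fun i => in_qpoly g 'X^i)
  (qpoly_co_linear (g := g)) (qpoly_basis gm g1) (qpoly_co_sum gm g1)
  (O' := full_subring K) (J := J) (e := in_qpoly g 'X).
- move=> x; split=> [/size1_polyC E i|H].
    by exists 0 => i0; rewrite /co E coefC (negbTE i0).
  apply/JpP; exists (x : {poly K})`_0; rewrite -[LHS]in_qpolyK.
  congr in_qpoly; apply/polyP => i; rewrite coefC; case: (posnP i) => [->//|i0].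
  have [id|di] := ltnP i d;
    last by rewrite nth_default // (leq_trans (size_qpoly gm g1 x)).
  have [w Hw] := H (Ordinal id).
  by apply: Hw; rewrite /= -lt0n.
- move=> a _ _ /JpP[b ->]; apply/JpP; exists (a * b).
  by rewrite polyCM mul_polyC in_qpolyZ.
- move=> _ /JpP[b ->]; apply/JpP; exists (b ^+ p).
  by rewrite polyC_exp [RHS]rmorphXn.
- apply/JpP; exists c; rewrite -rmorphXn -linearB /=.
  by apply/in_qpoly_eq.
(* Since [X^p - X] reduces to the constant [c], equality would give [b^p - b = c]. *)
- move=> _ /JpP[b ->]; rewrite -!rmorphXn -!linearB /= -?polyCB => E.
  apply: nc; exists b; apply: (@polyC_inj K).
  rewrite -constE E -constE; congr polyn.
  by apply/in_qpoly_eq.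
- apply: (moore_indep_exists charK) => s _; have [a aNs] := K_inf s.
  exists a => // v vs; rewrite /subunit !andbT subr_eq0.
  by apply: contraNneq aNs => ->.
- exact: nip.
Qed.

(** * Monic reduction of henselianity, and infinitude of the residue field *)

Section Residue.
Context (K : fieldType) (O : subringClosed K).
Hypothesis valO : forall x, x \in O \/ x^-1 \in O.
Local Notation m := (max_ideal valO).

(** The powers of [x] are distinct: a coincidence gives [x^n = 1] with [n > 0], whereas [x^-n] lies
    in [m]. *)
Lemma not_in_infinite x : x \notin O -> forall s : seq K, exists a, a \notin s.
Proof.
move=> nOx s; apply: contrapT => H.
have x0 : x != 0 by apply: contraNneq nOx => ->; rewrite rpred0.
have powers_uniq : uniq [seq x ^+ i | i <- iota 0 (size s).+1].
  have inj (i j : nat) : (i < j)%N -> x ^+ i <> x ^+ j.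
    move=> ij /eqP; rewrite -(subnK ij) addnS exprS exprD mulrA eq_sym
      -subr_eq0.
    rewrite -{2}[x ^+ i]mul1r -mulrBl mulf_eq0 expf_eq0 (negbTE x0) andbF orbF.
    rewrite subr_eq0 -exprS => /eqP E.
    have := maximal_idealX (j - i.+1) (maximal_ideal_inv valO nOx).
    by rewrite exprVn E invr1; apply/negP/maximal_ideal1.
  rewrite map_inj_in_uniq ?iota_uniq // => i j _ _ E; apply/eqP.
  by have [ij|ji|//] := ltngtP i j; [case: (inj _ _ ij)|case: (inj _ _ ji)].
have : (size [seq x ^+ i | i <- iota 0 (size s).+1] <= size s)%N.
  apply: uniq_leq_size => // a _; apply/negPn/negP => ns.
  by apply: H; exists a.
by rewrite size_map size_iota ltnn.
Qed.

(* With c = f(a) / f'(a), take for [h] the reciprocal polynomial of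
   f(a + c X) / f(a); a root z of [h] gives the root a + c / z of f. *)
Lemma henselian_of_monic :
  (forall k (h : {poly K}), h \is monic -> h \is a polyOver O ->
     h - 'X^k * ('X + 1) \is a polyOver m ->
     exists2 z, root h z & z + 1 \in m) ->
  henselian O.
Proof.
move=> H f a fO Oa mfa mf'a.
pose F := f \Po ('X + a%:P).
have FO : F \is a polyOver O by rewrite polyOver_comp // polyOverXaddC.
have F0 : F`_0 = f.[a] by rewrite -horner_coef0 horner_comp !hornerE.
have F1 : F`_1 = f^`().[a].
  rewrite -[LHS]mulr1n -coef_deriv -horner_coef0 deriv_comp hornerM horner_comp.
  by rewrite derivD derivX derivC !hornerE.
have uF1 : subunit O F`_1 by rewrite (subunitE (polyOverP FO _)) F1.
have [F10 _ OF1] := and3P uF1.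
have [fa0|fa0] := eqVneq f.[a] 0.
  by exists a; rewrite subrr; split=> //; [apply/eqP | exact: (rpred0 m)].
rewrite -F0 in mfa fa0.
pose c := F`_0 / F`_1;
  have mc : c \in m by rewrite /c mulrC [_ \in _]maximal_ideal_mull.
pose k := (size F).-2.
have sF : size F = k.+2.
  rewrite /k; have : (1 < size F)%N by apply: contraR F10;
    rewrite -leqNgt => /(nth_default 0) ->.
  by case: (size F) => [|[]].
pose E i := F`_(k.+1 - i) * c ^+ (k.+1 - i) / F`_0.
pose h := \poly_(i < k.+2) E i.
have Ek1 : E k.+1 = 1 by rewrite /E subnn expr0 mulr1 divff.
have Ek : E k = 1.
  by rewrite /E subSnn expr1 /c mulrCA mulfV // mulr1 divff.
(* With [j = k.+1 - i >= 2], [E i] is [F_j / F_1] times [c^(j-1)], because [F_0 = c F_1]. *)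
have Em i : (i < k)%N -> E i \in m.
  move=> ik; rewrite /E; have -> : (k.+1 - i = (k - i.+1).+2)%N by lia.
  rewrite exprS mulrA; set t := c ^+ _.
  have -> : F`_(k - i.+1).+2 * c * t / F`_0 = (F`_(k - i.+1).+2 / F`_1) * t.
    by rewrite /c; field; rewrite F10 fa0.
  apply: maximal_ideal_mull; last exact: maximal_idealX.
  by rewrite rpredM // (polyOverP FO).
have hm : h \is monic by rewrite monicE lead_coef_poly // Ek1 ?oner_eq0.
have hO : h \is a polyOver O.
  apply/polyOverP => i; rewrite coef_poly; case: ifP => _; last exact: rpred0.
  have [ik|] := ltnP i k; first exact/maximal_idealW/Em.
  rewrite leq_eqVlt => /orP[/eqP<-|]; first by rewrite Ek rpred1.
  rewrite leq_eqVlt => /orP[/eqP<-|ki]; first by rewrite Ek1 rpred1.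
  (* Beyond index [k.+1] the truncated subtraction makes [E i] equal to [F_0 / F_0 = 1]. *)
  by rewrite /E (_ : k.+1 - i = 0)%N; [rewrite expr0 mulr1 divff // rpred1|lia].
have hred : h - 'X^k * ('X + 1) \is a polyOver m.
  apply/polyOverP => i;
    rewrite mulrDr mulr1 -exprSr coefB coefD !coefXn coef_poly.
  have [->|i1] := eqVneq i k.+1;
    first by rewrite ltnSn Ek1 gtn_eqF // addr0 subrr rpred0.
  have [->|i0] := eqVneq i k; first by rewrite ltnW // Ek add0r subrr rpred0.
  rewrite addr0 subr0; case: ifP => ik; last exact: rpred0.
  by apply: Em; rewrite ltn_neqAle i0 -ltnS ltn_neqAle i1 -ltnS.
have [z /rootP hz mz] := H k h hm hO hred.
have uz : subunit O z.
  have Oz : z \in O by rewrite -(addrK 1 z) rpredB ?rpred1 // [_ \in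
    _]maximal_idealW.
  rewrite subunitE //; apply/negP => mz'.
  have : (z + 1) - z \in m by rewrite rpredB.
  by rewrite addrC addKr; apply/negP/maximal_ideal1.
have [z0 Oz Oz1] := and3P uz.
have mcz : c / z \in m by rewrite mulrC [_ \in _]maximal_ideal_mull.
exists (a + c / z); split.
- by rewrite rpredD // [_ \in _]maximal_idealW.
(* Reversing the sum gives [F(c / z) = F_0 h(z) / z^(k+1)]. *)
- have : F.[c / z] = 0.
    have := congr1 (fun t => F`_0 / z ^+ k.+1 * t) hz.
    rewrite mulr0 horner_poly mulr_sumr; apply: etrans; rewrite horner_coef sF.
    rewrite (reindex_inj rev_ord_inj) /=; apply: eq_bigr => i _.
    have ik : (i <= k.+1)%N by rewrite -ltnS.
    have -> : z ^+ k.+1 = z ^+ (k.+1 - i) * z ^+ i by rewrite -exprD subnK.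
    rewrite subSS /E expr_div_n; have := expf_neq0 (k.+1 - i) z0.
    have := expf_neq0 i z0; move: (z ^+ _) (z ^+ _) (c ^+ _) => u v w u0 v0.
    by field; rewrite u0 fa0 v0.
  by rewrite /root horner_comp !hornerE addrC => ->.
- by rewrite addrC addKr.
Qed.

Context (p : nat) (charK : p \in [pchar K]).

Let p_gt1 : (1 < p)%N := prime_gt1 (pcharf_prime charK).

(** For [y] outside [O], [y^-1] is in [m], and then so is [1 = (y^p - y) y^-p + y^(1-p)]. *)
Lemma expp_sub_integral y : y ^+ p - y \in O -> y \in O.
Proof.
move=> Oy; apply/negPn/negP => nOy; have my := maximal_ideal_inv valO nOy.
have y0 : y != 0 by apply: contraNneq nOy => ->; rewrite rpred0.
have : (y ^+ p - y) * y^-1 ^+ p + y^-1 ^+ p.-1 \in m.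
  case: p p_gt1 Oy => [|[|q]] // _ Oy.
  apply: rpredD; last exact: maximal_idealX.
  by apply: maximal_ideal_mull => //; apply: maximal_idealX.
have E : y * y^-1 ^+ p = y^-1 ^+ p.-1.
  by rewrite -{1}(prednK (ltnW p_gt1)) exprS mulVKf.
by rewrite mulrBl E subrK -exprMn mulfV // expr1n; apply/negP/maximal_ideal1.
Qed.

(* If [s] were a minimal set of representatives of the residue field, then
   y |-> y^p - y would permute the residues by surjectivity, although it
   identifies 0 and 1. *)
Lemma avoid_residues (AS : forall x : K, exists y, y ^+ p - y = x) (s : seq K) :
  {subset s <= O} -> exists2 a, a \in O & forall v, v \in s -> subunit O (a -
    v).
Proof.
have [n] := ubnP (size s); elim: n s => // n IH s sn sO.
apply: contrapT => H.
have rep x : x \in O -> exists2 v, v \in s & x - v \in m.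
  move=> Ox; apply: contrapT => Hx; apply: H; exists x => // v vs.
  have Ov := sO _ vs; rewrite subunitE ?rpredB //; apply/negP => mxv.
  by apply: Hx; exists v.
have [u us mu] := rep 0 (rpred0 _); have [w ws mw] := rep 1 (rpred1 _).
have Ou := sO _ us; have Ow := sO _ ws.
have wp_m x y : x \in O -> y \in O -> x - y \in m ->
    (x ^+ p - x) - (y ^+ p - y) \in m.
  move=> Ox Oy mxy; have -> : (x ^+ p - x) - (y ^+ p - y) = (x - y) ^+ p - (x -
    y).
    by rewrite (expBp charK); move: (x ^+ p) (y ^+ p) => a b; ring.
  by rewrite rpredB // -(prednK (ltnW p_gt1)) [_ \in _]maximal_idealX.
have wu : w != u.
  apply/negP => /eqP wu; have : (1 - w) - (0 - u) \in m by apply: rpredB.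
  by rewrite wu sub0r opprK subrK; apply/negP/maximal_ideal1.
(* [u] represents 0 and [w] represents 1. Without [u] the list of images is shorter than [s], so by
   induction some residue [a] avoids it. *)
pose s' := [seq v ^+ p - v | v <- rem u s].
have s's : {subset rem u s <= s} by apply: mem_rem.
have mem_rem_neq x : x \in s -> x != u -> x \in rem u s.
  by rewrite (perm_mem (perm_to_rem us)) inE => /orP[->|].
have s'O : {subset s' <= O}.
  by move=> _ /mapP[v /s's/sO Ov ->]; rewrite rpredB ?rpredX.
have s'n : (size s' < n)%N.
  have s0 : (0 < size s)%N by apply: leq_ltn_trans (leq0n _) (_ : index u s <
    _)%N; rewrite index_mem.
  by rewrite size_map size_rem // prednK.
have [a Oa aH] := IH s' s'n s'O; have [y ya] := AS a.
have Oy : y \in O by apply: expp_sub_integral; rewrite ya.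
have [v vs myv] := rep y Oy; have Ov := sO _ vs.
have [v' v's mav] : exists2 v', v' \in rem u s & a - (v' ^+ p - v') \in m.
  (* If [y] reduces to 0, then [w] replaces [u], since 0 and 1 have the same image. *)
  have [vu|vu] := eqVneq v u; last first.
    by exists v; [rewrite mem_rem_neq|rewrite -ya wp_m].
  rewrite vu in myv; exists w; first by rewrite mem_rem_neq.
  have -> : a - (w ^+ p - w) = ((y ^+ p - y) - (u ^+ p - u))
      + ((1 ^+ p - 1) - (w ^+ p - w)) - ((0 ^+ p - 0) - (u ^+ p - u)).
    rewrite ya expr1n subr0 expr0n -[p == 0%N]negbK -lt0n (ltnW p_gt1) /=.
    by move: (w ^+ p) (u ^+ p) => b c; ring.
  have O0 : 0 \in O := rpred0 _; have O1 : 1 \in O := rpred1 _.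
  by apply: rpredB; [apply: rpredD|]; apply: wp_m.
have := aH _ (map_f _ v's); have Ov' := sO _ (s's _ v's).
by rewrite subunitE ?rpredB ?rpredX // => /negP; apply.
Qed.

End Residue.

(** * Lifting simple roots *)

Lemma irreducible_dvd_prod (K : fieldType) (g : {poly K}) (I : eqType) (s : seq
  I)
    (F : I -> {poly K}) :
  irreducible_poly g -> g %| \prod_(i <- s) F i -> exists2 i, i \in s & g %| F
    i.
Proof.
move=> g_irr; elim: s => [|i s IH]; rewrite ?big_nil ?big_cons.
  by rewrite dvdp1; case: g_irr => /ltn_eqF; rewrite eq_sym => ->.
have [gi _|ngi] := boolP (g %| F i); first by exists i; rewrite ?mem_head.
rewrite Gauss_dvdpr; last by rewrite irreducible_poly_coprime.
by move=> /IH[j js gj]; exists j => //; rewrite inE js orbT.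
Qed.

Section Lifting.
Context (K : fieldType) (O : subringClosed K) (p : nat).
Hypothesis valO : forall x, x \in O \/ x^-1 \in O.
Hypothesis charK : p \in [pchar K].
Local Notation m := (max_ideal valO).

Let p_gt1 : (1 < p)%N := prime_gt1 (pcharf_prime charK).

(** A nonzero element of the prime field satisfies [n^(p-1) = 1], so it is not in [m]. *)
Lemma nat_maximal_ideal n : n%:R \in m -> n%:R = 0 :> K.
Proof.
move=> mn; apply/eqP/negPn/negP => n0.
have := maximal_idealX p.-2 mn.
have -> : n%:R ^+ p.-2.+1 = 1 :> K.
  apply: (mulfI n0); rewrite mulr1 -exprS.
  by case: p p_gt1 charK => [|[|q]] // _ c;
    rewrite -(pFrobenius_autE c) rmorph_nat.
exact/negP/maximal_ideal1.
Qed.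

Lemma polyOver_max_idealM (q r : {poly K}) :
  q \is a polyOver O -> r \is a polyOver m -> q * r \is a polyOver m.
Proof.
move=> qO rm; apply/polyOverP => i; rewrite coefM rpred_sum // => j _.
by apply: maximal_ideal_mull; rewrite ?(polyOverP qO) ?[_ \in _](polyOverP rm).
Qed.

Lemma polyOver_max_idealW (q : {poly K}) : q \is a polyOver m -> q \is a
  polyOver O.
Proof. by move=> /polyOverP qm; apply/polyOverP => i;
  apply: maximal_idealW. Qed.

Lemma horner_max_ideal (q : {poly K}) x :
  q \is a polyOver m -> x \in O -> q.[x] \in m.
Proof.
move=> /polyOverP qm Ox; rewrite horner_coef rpred_sum // => i _; rewrite mulrC.
by apply: maximal_ideal_mull; rewrite ?rpredX.
Qed.

(** A monic irreducible factor [g] of [h] with [g(-1)] in [m] gives the root if it is linear.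
    Otherwise [A = K[X]/(g)] and [e = (-X)^k] contradict NIP through [artin_schreier_IP]. *)
Lemma lift_simple_root k (h : {poly K}) :
  (forall m n (phi : formula (m + n)),
     existential phi -> NIP (Th (valued_field_structure O)) phi) ->
  (forall N, exists2 s, size s = N & moore_indep p O s) ->
  h \is monic -> h \is a polyOver O -> h - 'X^k * ('X + 1) \is a polyOver m ->
  exists2 z, root h z & z + 1 \in m.
Proof.
move=> nip indep hm hO; set r := h - _ => rm.
have hE : h = 'X^k * ('X + 1) + r by rewrite /r addrC subrK.
apply: contrapT => nroot.
have ON1 : -1 \in O by rewrite rpredN1.
have mh1 : h.[-1] \in m.
  rewrite hE hornerD hornerM hornerD hornerX -polyC1 hornerC addNr mulr0 add0r.
  exact: horner_max_ideal.
have [g [gm g_irr gO mg gh]] := irreducible_factor valO ON1 hm hO mh1.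
have g1 : (1 < size g)%N by case: g_irr.
have g2 : (2 < size g)%N.
  rewrite ltn_neqAle g1 andbT eq_sym; apply/negP => /eqP sg; apply: nroot.
  have gE : g = 'X + (g`_0)%:P.
    apply/polyP => -[|[|i]]; rewrite coefD coefX coefC ?add0r ?addr0 //=.
      by move/monicP: gm; rewrite lead_coefE sg.
    by rewrite nth_default // sg.
  exists (- g`_0); first by rewrite -dvdp_XsubCl polyCN opprK -gE.
  suff -> : - g`_0 + 1 = - g.[-1] by rewrite rpredN.
  by rewrite gE !hornerE coefD coefX coefC /=; ring.
pose A : comAlgType K := {poly %/ g}.
pose d := (size g).-1.
(* Division by the monic [g] shows that [J] is the image of [m[X]]. *)
pose Jp : {pred A} := [pred x : A | (x : {poly K}) \is a polyOver m].
have Jin (q : {poly K}) : q \is a polyOver m -> in_qpoly g q \in Jp.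
  move=> qm; rewrite inE in_qpolyE //.
  by have [] := monic_division (S := m) (@maximal_ideal_mull _ O) gm gO qm.
have JpP x : reflect (exists2 q : {poly K}, q \is a polyOver m & x = in_qpoly g
  q)
    (x \in Jp).
  apply: (iffP idP) => [mx|[q mq ->]]; last exact: Jin.
  by exists (x : {poly K}); rewrite ?in_qpolyK.
have JpB : zmod_closed Jp.
  split=> [|_ _ /JpP[q mq ->] /JpP[q' mq' ->]].
    by rewrite -(in_qpoly0 g); apply/Jin/rpred0.
  by rewrite -linearB; apply/Jin/rpredB.
pose J : zmodClosed A := HB.pack Jp (GRing.isZmodClosed.Build A Jp JpB).
(* [m] is existentially definable: a nonzero element is in [m] iff its inverse lies outside [O]. *)
pose theta n (i : 'I_d) (t u : term n) : formula n :=
  Or (Equal t (Zero n)) (And (Equal (Mul t u) (One n)) (Not (Pred u))).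
pose T (i : 'I_d) (y w : K) := y = 0 \/ y * w = 1 /\ ~ w \in O.
have mT i y : y \in m <-> exists w, T i y w.
  split=> [/andP[_ /orP[/eqP->|/negP nOy]]|[w [->|[yw /negP nOw]]]].
  - by exists 0; left.
  - have [->|y0] := eqVneq y 0; first by exists 0; left.
    by exists y^-1; right; rewrite mulfV.
  - exact: rpred0.
  - have -> : y = w^-1.
      have w0 : w != 0 by apply: contraNneq nOw => ->; apply: rpred0.
      by apply: (mulIf w0); rewrite yw mulVf.
    exact: (maximal_ideal_inv valO nOw).
(* The sign makes [t(-1) = 1], while [t (X + 1)] is [h] up to sign modulo [m[X]]. *)
pose t : {poly K} := (- 'X) ^+ k.
have tO : t \is a polyOver O by rewrite rpredX // rpredN polyOverX.
pose s : K := (-1) ^+ k.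
have tE : t = s *: 'X^k by rewrite /t /s -scaleN1r exprZn.
have Os : s \in O by rewrite rpredX.
have srm : s *: r \is a polyOver m.
  by rewrite -mul_polyC; apply: polyOver_max_idealM; rewrite ?polyOverC.
have tX : t * ('X + 1) = s *: h - s *: r.
  by rewrite tE -scalerBr hE addrK scalerAl.
(* [t^p - t = t ((-X)^(k(p-1)) - 1)], and [X + 1] divides the second factor. *)
have wpt : exists2 v, v \is a polyOver O & t ^+ p - t = (t * ('X + 1)) * v.
  exists (- \sum_(i < (k * p.-1)%N) (- 'X) ^+ i).
    by rewrite rpredN rpred_sum // => i _; rewrite rpredX // rpredN polyOverX.
  have -> : t ^+ p = t * (- 'X) ^+ (k * p.-1).
    by rewrite exprM -exprS prednK // ltnW.
  by rewrite -{2}[t]mulr1 -mulrBr subrX1; ring.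
have [v Ov tv] := wpt.
have charA : p \in [pchar A] by rewrite pchar_lalg.
have wp_in q : (in_qpoly g q : A) ^+ p - in_qpoly g q = in_qpoly g (q ^+ p - q).
  by rewrite linearB rmorphXn.
have theta_qf n i (a b : term n) : quantifier_free (theta n i a b) by [].
have theta_sat n i (a b : term n) (e : 'I_n -> valued_field_structure O) :
  sat (theta n i a b) e <-> T i (eval e a) (eval e b) by [].
have [||||||phi ex_phi] := artin_schreier_IP theta_qf theta_sat charK
  (A := A) (co := fun x (i : 'I_d) => (x : {poly K})`_i)
  (basis := fun i => in_qpoly g 'X^i)
  (qpoly_co_linear (g := g)) (qpoly_basis gm g1) (qpoly_co_sum gm g1)
  (O' := O) (J := J) (e := in_qpoly g t).
- move=> x; split=> [/polyOverP xm i|H]; first exact/mT.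
  apply/polyOverP => i; have [di|id] := ltnP i d.
    by have /mT := H (Ordinal di).
  by rewrite nth_default ?rpred0 // (leq_trans (size_qpoly gm g1 x)).
- move=> a _ Oa /JpP[q mq ->]; rewrite -in_qpolyZ; apply: Jin.
  by rewrite -mul_polyC; apply: polyOver_max_idealM; rewrite ?polyOverC.
- move=> _ /JpP[q mq ->]; rewrite -rmorphXn; apply: Jin.
  rewrite -(prednK (ltnW p_gt1)) exprSr; apply: polyOver_max_idealM => //.
  by rewrite rpredX // polyOver_max_idealW.
- apply/JpP; exists (- (v * (s *: r))).
    by rewrite rpredN; apply: polyOver_max_idealM.
  rewrite wp_in; apply/in_qpoly_eq => //.
  rewrite opprK tv tX [_ * v]mulrC -mulrDr subrK -scalerAr.
  by rewrite dvdpZr ?dvdp_mull // /s signr_eq0.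
(* If [wp(q) = wp(t)] modulo [g], the irreducible [g] divides [wp(q - t)], hence some factor
   [q - t - c] with [c] in F_p. *)
- move=> _ /JpP[q mq ->]; rewrite !wp_in => /in_qpoly_eq; move=> /(_ gm g1).
  have -> : q ^+ p - q - (t ^+ p - t) = (q - t) ^+ p - (q - t).
    rewrite (expBp (p := p)) ?pchar_lalg //.
    by move: (q ^+ p) (t ^+ p) => a b; ring.
  rewrite poly_expp_sub // => /(irreducible_dvd_prod g_irr)[c _ gc].
  have Oq := polyOver_max_idealW mq.
  have mc : (q - t - c%:R%:P).[-1] \in m.
    have Ow : q - t - c%:R%:P \is a polyOver O.
      by rewrite !rpredB // polyOverC rpred_nat.
    have [Od _] := monic_division (S := O) (@rpredM _ O) gm gO Ow.
    rewrite -(divpK gc) hornerM; apply: maximal_ideal_mull => //.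
    exact: rpred_horner.
  (* At -1 both [q] and [q - t - c] have values in [m] and [t] is 1, so [c + 1] is in [m]. *)
  have c1 : c.+1%:R = 0 :> K.
    apply: nat_maximal_ideal.
    have -> : c.+1%:R = q.[-1] - (q - t - c%:R%:P).[-1].
      by rewrite /t !hornerE opprK expr1n -natr1; ring.
    by rewrite rpredB // horner_max_ideal.
  have cN1 : c%:R = -1 :> K by apply/eqP; rewrite -addr_eq0 natr1 c1.
  (* Multiplying [q - t + 1] by [X + 1] and adding [s h] eliminates [t]. *)
  have gX : g %| ('X + 1) - - (('X + 1) * q + s *: r).
    have -> : ('X + 1) - - (('X + 1) * q + s *: r) =
        ('X + 1) * (q - t - c%:R%:P) + s *: h.
      have -> : s *: h = t * ('X + 1) + s *: r by rewrite tX subrK.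
      by rewrite cN1 polyCN polyC1; move: (s *: r) => b; ring.
    by rewrite dvdp_add // ?dvdp_mull // dvdpZr // signr_eq0.
  have mX : - (('X + 1) * q + s *: r) \is a polyOver m.
    rewrite rpredN rpredD //; apply: polyOver_max_idealM => //.
    by rewrite rpredD ?polyOverX // rpred1.
  have [_] := monic_division (S := m) (@maximal_ideal_mull _ O) gm gO mX.
  (* As [g] has degree at least 2, [X + 1] is its own remainder, so its constant coefficient 1 would
     be in [m]. *)
  have -> : (- (('X + 1) * q + s *: r)) %% g = 'X + 1.
    apply/eqP; rewrite -[X in _ == X](modp_small (_ : (size ('X + 1)%R < size
      g)%N)).
      by rewrite eq_sym -subr_eq0 -modpN -modpD; apply/eqP/modp_eq0P.
    by rewrite -polyC1 size_XaddC.
  move=> /polyOverP/(_ 0%N); rewrite coefD coefX coef1 add0r.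
  exact/negP/maximal_ideal1.
- exact: indep.
- exact: nip.
Qed.

End Lifting.

Theorem theorem5p16 (K : fieldType) (O : {pred K}) (p : nat)
    (charK : p \in [pchar K])
    (valO : valuation_ring O)
    (nip : forall (m n : nat) (phi : formula (m + n)),
       existential phi -> NIP (Th (valued_field_structure O)) phi) :
  henselian O.
Proof.
have [O_subring O_val] := valO.
(* For [O = K] the ideal [m] is zero and [a] itself is the root; otherwise an element outside [O]
   makes [K] infinite. *)
have [O_full|] := pselect (forall x, x \in O).
  move=> f a _ Oa /andP[_]; rewrite O_full orbF => /eqP fa0 _.
  exists a; split=> //; first exact/eqP.
  by rewrite subrr inE /= eqxx O_full.
case/existsNP => x /negP nOx.
pose O' : subringClosed K := HB.pack O (GRing.isSubringClosed.Build K O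
  O_subring).
have K_inf := not_in_infinite (O := O') O_val nOx.
have AS := artin_schreier_closed charK nip K_inf.
have indep := moore_indep_exists charK (avoid_residues (O := O') O_val charK
  AS).
apply: (henselian_of_monic (O := O') (valO := O_val)) => k h hm hO hr.
exact: (lift_simple_root (O := O') charK nip indep hm hO hr).
Qed.
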